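(* Let $f:\mathbb{R}^n\to\mathbb{R}$ be convex, let $C\subset\mathbb{R}^n$ be a closed convex compact set, let $F:\mathbb{R}^n\to\mathbb{R}^n$ be continuous and monotone, and assume the solution set of $\mathrm{VI}(F,C)$ is nonempty. Consider the simple MPEC problem of minimizing $f$ over the solution set of $\mathrm{VI}(F,C)$, and let $g_D$ be the dual gap function of $\mathrm{VI}(F,C)$. Let $\{\varepsilon_k\}$ be a sequence of positive reals with $\varepsilon_k\downarrow 0$, let $\lambda_k>0$ for each $k$, and let $\{x_k\}$ be a sequence generated by $$x_{k+1}=\operatorname{argmin}_{x\in C}\Big\{g_D(x)+\varepsilon_k f(x)+\frac{1}{2\lambda_k}\|x-x_k\|^2\Big\}.$$ Let $\delta>0$ be the given threshold. If for $k$ sufficiently large we have $$\|x_{k+1}-x_k\|\le\lambda_k\varepsilon_k\delta,$$ then the stopping criterion holds at $x_{k+1}$, with threshold $\delta$.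
   Context: $\mathrm{VI}(F,C)$ asks for $x\in C$ with $\langle F(x),y-x\rangle\ge 0$ for all $y\in C$. The map $F$ is monotone if $\langle F(y)-F(x),y-x\rangle\ge 0$ for all $x,y\in\mathbb{R}^n$. The dual gap function is $g_D(x)=\sup_{y\in C}\langle F(y),x-y\rangle$, $x\in\mathbb{R}^n$. A point $\bar x$ satisfies the $\delta$-Lagrange multiplier rule ($\delta>0$) for the simple MPEC problem if there exist $u\in\partial f(\bar x)$, $w\in\partial g_D(\bar x)$, $v\in N_C(\bar x)$ and $\lambda\ge 0$ such that $\|u+\lambda w+v\|\le\delta$; here $\partial$ is the convex subdifferential, $N_C(\bar x)=\{v:\langle v,x-\bar x\rangle\le 0\ \forall x\in C\}$ is the normal cone, and $\|\cdot\|$ is the Euclidean norm. The stopping criterion with threshold $\delta$ holds at an iterate if the iterate satisfies the $\delta$-Lagrange multiplier rule; such an iterate is then accepted as an approximate solution of the simple MPEC problem. *)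

(* Defs.v *)
From HB Require Import structures.
From mathcomp Require Import all_boot all_order all_algebra.
From mathcomp Require Import all_classical all_reals all_analysis.

Set Implicit Arguments.
Unset Strict Implicit.
Unset Printing Implicit Defensive.

Import Order.TTheory GRing.Theory Num.Theory.
Import numFieldNormedType.Exports.

Local Open Scope classical_set_scope.
Local Open Scope ring_scope.

Definition dotv (R : realType) (n : nat) (x y : 'rV[R]_n) : R :=
  \sum_(i < n) x ord0 i * y ord0 i.

(* The library norm `|x| on 'rV[R]_n is the sup norm; its topology is the
   usual one, but Euclidean lengths have to go through enorm. *)
Definition enorm (R : realType) (n : nat) (x : 'rV[R]_n) : R :=
  Num.sqrt (dotv x x).

Definition monotone_map (R : realType) (n : nat)
    (F : 'rV[R]_n -> 'rV[R]_n) : Prop :=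
  forall x y, 0 <= dotv (F y - F x) (y - x).

Definition vi_solutions (R : realType) (n : nat)
    (F : 'rV[R]_n -> 'rV[R]_n) (C : set 'rV[R]_n) : set 'rV[R]_n :=
  [set x | C x /\ forall y, C y -> 0 <= dotv (F x) (y - x)].

(* The real supremum is only meaningful for a nonempty set that is bounded
   above, which holds here when C is nonempty and compact and F is
   continuous. *)
Definition dual_gap (R : realType) (n : nat)
    (F : 'rV[R]_n -> 'rV[R]_n) (C : set 'rV[R]_n) (x : 'rV[R]_n) : R :=
  sup [set dotv (F y) (x - y) | y in C].

Definition subdifferential (R : realType) (n : nat)
    (h : 'rV[R]_n -> R) (x : 'rV[R]_n) : set 'rV[R]_n :=
  [set u | forall y, h x + dotv u (y - x) <= h y].

Definition normal_cone (R : realType) (n : nat)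
    (C : set 'rV[R]_n) (x : 'rV[R]_n) : set 'rV[R]_n :=
  [set v | forall y, C y -> dotv v (y - x) <= 0].

Definition argmin_on (R : realType) (n : nat)
    (C : set 'rV[R]_n) (h : 'rV[R]_n -> R) : set 'rV[R]_n :=
  [set x | C x /\ forall y, C y -> h x <= h y].

Definition lagrange_multiplier_rule (R : realType) (n : nat)
    (f : 'rV[R]_n -> R) (F : 'rV[R]_n -> 'rV[R]_n) (C : set 'rV[R]_n)
    (delta : R) (x : 'rV[R]_n) : Prop :=
  exists u w v : 'rV[R]_n, exists lambda : R,
    [/\ subdifferential f x u,
        subdifferential (dual_gap F C) x w,
        normal_cone C x v,
        0 <= lambda
      & enorm (u + lambda *: w + v) <= delta].

Definition stopping_criterion (R : realType) (n : nat)
    (f : 'rV[R]_n -> R) (F : 'rV[R]_n -> 'rV[R]_n) (C : set 'rV[R]_n)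
    (delta : R) (x : 'rV[R]_n) : Prop :=
  lagrange_multiplier_rule f F C delta x.

(* Main.v *)
(* First-order optimality of the proximal step. The quadratic term can be
   replaced by its linearization at x_(k+1), so the sum rule gives
   w + eps_k u + v + (x_(k+1) - x_k) / lambda_k = 0 with w, u subgradients of g_D
   and f, and v normal to C. Dividing by eps_k yields the multiplier rule with
   multiplier 1 / eps_k and residual ||x_(k+1) - x_k|| / (lambda_k eps_k). *)
Require Import Defs.
From HB Require Import structures.
From mathcomp Require Import all_boot all_order all_algebra.
From mathcomp Require Import all_classical all_reals all_analysis.
From mathcomp Require Import ring lra.

Set Implicit Arguments.
Unset Strict Implicit.
Unset Printing Implicit Defensive.

Import Order.TTheory GRing.Theory Num.Theory.
Import numFieldNormedType.Exports.

Local Open Scope classical_set_scope.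
Local Open Scope ring_scope.

(** * The Euclidean inner product and norm *)

Lemma dotvC (R : realType) n (x y : 'rV[R]_n) : dotv x y = dotv y x.
Proof. by apply: eq_bigr => i _; rewrite mulrC. Qed.

Lemma dotvDl (R : realType) n (x y z : 'rV[R]_n) :
  dotv (x + y) z = dotv x z + dotv y z.
Proof. by rewrite -big_split; apply: eq_bigr => i _; rewrite !mxE mulrDl. Qed.

Lemma dotvZl (R : realType) n (a : R) (x z : 'rV[R]_n) :
  dotv (a *: x) z = a * dotv x z.
Proof. by rewrite mulr_sumr; apply: eq_bigr => i _; rewrite !mxE mulrA. Qed.

Lemma dotvNl (R : realType) n (x z : 'rV[R]_n) : dotv (- x) z = - dotv x z.
Proof. by rewrite -scaleN1r dotvZl mulN1r. Qed.

Lemma dotvDr (R : realType) n (x y z : 'rV[R]_n) :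
  dotv x (y + z) = dotv x y + dotv x z.
Proof. by rewrite dotvC dotvDl !(dotvC x). Qed.

Lemma dotvZr (R : realType) n (a : R) (x z : 'rV[R]_n) :
  dotv x (a *: z) = a * dotv x z.
Proof. by rewrite dotvC dotvZl dotvC. Qed.

Lemma dotvNr (R : realType) n (x z : 'rV[R]_n) : dotv x (- z) = - dotv x z.
Proof. by rewrite dotvC dotvNl dotvC. Qed.

Lemma dotv0r (R : realType) n (x : 'rV[R]_n) : dotv x 0 = 0.
Proof. by rewrite -(scale0r 0) dotvZr mul0r. Qed.

Definition dotvE := (dotvDl, dotvDr, dotvNl, dotvNr, dotvZl, dotvZr, dotv0r).

Lemma dotv_delta (R : realType) n (x : 'rV[R]_n) i :
  dotv x (delta_mx ord0 i) = x ord0 i.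
Proof.
rewrite /dotv (bigD1 i) //= big1 ?addr0 => [|j ji].
  by rewrite mxE !eqxx mulr1.
by rewrite mxE (negbTE ji) andbF mulr0.
Qed.

Lemma dotv_row_mx (R : realType) m n (x : 'rV[R]_(m + n)) (a : 'rV[R]_m)
    (b : 'rV[R]_n) :
  dotv x (row_mx a b) = dotv (lsubmx x) a + dotv (rsubmx x) b.
Proof.
rewrite /dotv big_split_ord /=; congr (_ + _); apply: eq_bigr => i _.
  by rewrite row_mxEl mxE.
by rewrite row_mxEr mxE.
Qed.

Lemma dotv_ge0 (R : realType) n (x : 'rV[R]_n) : 0 <= dotv x x.
Proof. by apply: sumr_ge0 => i _; rewrite -expr2 sqr_ge0. Qed.

Lemma enorm_sqr (R : realType) n (x : 'rV[R]_n) : enorm x ^+ 2 = dotv x x.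
Proof. by rewrite sqr_sqrtr ?dotv_ge0. Qed.

Lemma enormZ (R : realType) n (a : R) (x : 'rV[R]_n) :
  enorm (a *: x) = `|a| * enorm x.
Proof. by rewrite /enorm !dotvE mulrA -expr2 sqrtrM ?sqr_ge0 // sqrtr_sqr. Qed.

(** Duality of the l1 and sup norms: [|y|] is the sup norm, the one in which boundedness of a set is
    expressed. *)
Lemma dotv_le_norm (R : realType) n (x y : 'rV[R]_n) :
  dotv x y <= (\sum_(i < n) `|x ord0 i|) * `|y|.
Proof.
rewrite mulr_suml; apply: ler_sum => i _.
apply: le_trans (ler_norm _) _; rewrite normrM ler_wpM2l //.
rewrite [leRHS]mx_normrE.
exact: (le_bigmax _ (fun i => `|y i.1 i.2|) (ord0, i)).
Qed.

(** * Convexity and existence of subgradients *)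

(** The weight is a plain real with two bounds, so that instances feed directly into linear
    arithmetic. *)
Definition is_convex (R : realType) (V : lmodType R) (h : V -> R) : Prop :=
  forall (t : R) (x y : V), 0 <= t -> t <= 1 ->
    h (t *: x + (1 - t) *: y) <= t * h x + (1 - t) * h y.

Lemma convex_function_is_convex (R : realType) (V : lmodType R) (h : V -> R) :
  convex_function [set: convex_lmodType V] h -> is_convex h.
Proof.
move=> hcvx t x y t0 t1.
by have := hcvx (Itv01 t0 t1) x y; rewrite !inE; apply.
Qed.

Lemma convex_setP (R : realType) (V : lmodType R) (C : set V) (t : R)
    (x y : V) :
  convex_set (C : set (convex_lmodType V)) -> C x -> C y -> 0 <= t -> t <= 1 ->
  C (t *: x + (1 - t) *: y).
Proof.
move=> Ccvx Cx Cy t0 t1.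
by have := Ccvx x y (Itv01 t0 t1); rewrite !inE; apply.
Qed.

(* The admissible slopes [c] are those lying above all backward difference
   quotients and below all forward ones; convexity makes the former smaller. *)
Lemma hahn_banach_step (R : realType) (V : lmodType R) (h l : V -> R)
    (W : V -> Prop) (e : V) :
  is_convex h ->
  (forall t x y, W x -> W y -> W (t *: x + (1 - t) *: y)) -> W 0 ->
  (forall t x y, l (t *: x + (1 - t) *: y) = t * l x + (1 - t) * l y) ->
  (forall w, W w -> l w <= h w) ->
  exists c, forall w s, W w -> l w + s * c <= h (w + s *: e).
Proof.
move=> hcvx Wcvx W0 lE lh.
pose lo := [set c | exists w s,
  [/\ W w, 0 < s & c = (l w - h (w - s *: e)) / s]].
have lo_up w s : W w -> 0 < s -> ubound lo ((h (w + s *: e) - l w) / s).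
  move=> Ww s0 _ [w' [s' [Ww' s'0 ->]]].
  rewrite ler_pdivrMr // mulrAC ler_pdivlMr //.
  have ss0 : 0 < s + s' by rewrite addr_gt0.
  (* The weight with [t * s = (1 - t) * s']: the [e]-components of the forward and backward points
     cancel, leaving a point of [W]. *)
  pose t := s' / (s + s').
  have t1E : 1 - t = s / (s + s') by rewrite /t; field; rewrite gt_eqF.
  have t0 : 0 <= t by rewrite divr_ge0 ?ltW.
  have t1 : t <= 1 by rewrite -subr_ge0 t1E divr_ge0 ?ltW.
  have := hcvx t (w + s *: e) (w' - s' *: e) t0 t1.
  have -> : t *: (w + s *: e) + (1 - t) *: (w' - s' *: e) =
            t *: w + (1 - t) *: w'.
    rewrite !scalerDr scalerN !scalerA addrACA -scaleNr -scalerDl.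
    suff -> : t * s - (1 - t) * s' = 0 by rewrite scale0r addr0.
    by rewrite t1E /t; field; rewrite gt_eqF.
  move=> /(le_trans (lh _ (Wcvx t _ _ Ww Ww'))).
  rewrite lE t1E /t -(ler_pM2r ss0) !mulrDl.
  have cancel a b : a / (s + s') * b * (s + s') = a * b.
    by field; rewrite gt_eqF.
  by rewrite !cancel; lra.
have lo_nonempty : lo !=set0.
  by exists ((l 0 - h (0 - 1 *: e)) / 1), 0, 1.
have lo_sup : has_sup lo.
  by split=> //; exists ((h (0 + 1 *: e) - l 0) / 1); exact: lo_up.
exists (sup lo) => w s Ww.
have [s0|s0|->] := ltgtP s 0; last by rewrite mul0r scale0r !addr0 lh.
- have : (l w - h (w - (- s) *: e)) / - s <= sup lo.
    by apply: ub_le_sup; [case: lo_sup | exists w, (- s); rewrite oppr_gt0].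
  by rewrite ler_pdivrMr ?oppr_gt0 // scaleNr opprK; lra.
- have : sup lo <= (h (w + s *: e) - l w) / s.
    by apply: ge_sup => //; exact: lo_up.
  by rewrite ler_pdivlMr //; lra.
Qed.

(** Induction on [k]: an affine minorant on the vectors supported on the first [k] coordinates
    extends along the next basis vector by [hahn_banach_step]. *)
Lemma subdifferential0_nonempty (R : realType) (m : nat) (h : 'rV[R]_m -> R) :
  is_convex h -> subdifferential h 0 !=set0.
Proof.
move=> hcvx.
suff /(_ m) [u uP] : forall k, exists u : 'rV[R]_m, forall y : 'rV[R]_m,
    (forall i : 'I_m, (k <= i)%N -> y ord0 i = 0) -> h 0 + dotv u y <= h y.
  exists u => y; rewrite subr0; apply: uP => i.
  by rewrite leqNgt ltn_ord.
elim=> [|k [u uP]].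
  exists 0 => y y0; have -> : y = 0 by apply/rowP => i; rewrite y0 ?mxE.
  by rewrite dotv0r addr0.
have [mk|km] := leqP m k.
  exists u => y _; apply: uP => i ki.
  by have := ltn_ord i; rewrite ltnNge (leq_trans mk).
pose e : 'rV[R]_m := delta_mx ord0 (Ordinal km).
pose W (y : 'rV[R]_m) := forall i : 'I_m, (k <= i)%N -> y ord0 i = 0.
have [||||c cP] := @hahn_banach_step R _ h (fun y => h 0 + dotv u y) W e hcvx.
- by move=> t x y Wx Wy i ki; rewrite !mxE Wx // Wy // !mulr0 addr0.
- by move=> i _; rewrite mxE.
- by move=> t x y; rewrite !dotvE; ring.
- exact: uP.
(* The slope along [e] must be exactly [c], so the old coordinate of [u] there is removed. *)
exists (u + (c - u ord0 (Ordinal km)) *: e) => y y0.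
pose s := y ord0 (Ordinal km).
have yE : y = (y - s *: e) + s *: e by rewrite subrK.
have Wy : W (y - s *: e).
  move=> i; rewrite leq_eqVlt => /orP[/eqP ki|/y0 yi].
    have -> : i = Ordinal km by apply: val_inj.
    by rewrite !mxE !eqxx mulr1 subrr.
  rewrite !mxE yi /= sub0r; case: eqP => [iE|_]; last by rewrite mulr0 oppr0.
  by move: yi; rewrite iE -/s => ->; rewrite mul0r oppr0.
have := cP _ s Wy; rewrite -yE.
by rewrite !dotvE dotv_delta [dotv e y]dotvC dotv_delta -/s; lra.
Qed.

(** * The sum rule at a constrained minimizer *)

(** Near-minimizers for [a] and [a'] combine into a competitor for the combined parameter. The
    infimum may not be attained, hence the slack [d] in the proof. *)
Lemma inf_convex (R : realType) (V U : lmodType R) (C : set V)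
    (psi : V -> U -> R) :
  convex_set (C : set (convex_lmodType V)) -> C !=set0 ->
  (forall a, has_lbound [set psi z a | z in C]) ->
  (forall t z z' a a', C z -> C z' -> 0 <= t -> t <= 1 ->
    psi (t *: z + (1 - t) *: z') (t *: a + (1 - t) *: a') <=
    t * psi z a + (1 - t) * psi z' a') ->
  is_convex (fun a => inf [set psi z a | z in C]).
Proof.
move=> Ccvx [z0 Cz0] lb psicvx t a a' t0 t1.
have hi b : has_inf [set psi z b | z in C] by split; [exists (psi z0 b), z0|].
apply/ler_addgt0Pr => d d0.
have [_ [z Cz <-] zlt] := inf_adherent d0 (hi a).
have [_ [z' Cz' <-] zlt'] := inf_adherent d0 (hi a').
apply: (@le_trans _ _ (t * psi z a + (1 - t) * psi z' a')).
  apply: le_trans (psicvx t z z' a a' Cz Cz' t0 t1).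
  apply: ge_inf; first exact: lb.
  by exists (t *: z + (1 - t) *: z') => //; exact: convex_setP.
have : t * psi z a <= t * (inf [set psi z a | z in C] + d).
  by rewrite ler_wpM2l // ltW.
have : (1 - t) * psi z' a' <= (1 - t) * (inf [set psi z a' | z in C] + d).
  by rewrite ler_wpM2l ?subr_ge0 // ltW.
lra.
Qed.

(* Perturb the arguments of [g] and [f] independently, by [a] and [b]: the
   minimal value over [C] is then finite and convex in [(a, b)], and a
   subgradient of it at [0] splits into subgradients of [g] and [f]. *)
Lemma argmin_on_sum_rule (R : realType) (n : nat) (C : set 'rV[R]_n)
    (g f : 'rV[R]_n -> R) (d p : 'rV[R]_n) :
  convex_set (C : set (convex_lmodType 'rV[R]_n)) ->
  is_convex g -> is_convex f ->
  argmin_on C (fun z => g z + f z + dotv d z) p ->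
  exists w u v, [/\ subdifferential g p w, subdifferential f p u,
                    normal_cone C p v & w + u + v = - d].
Proof.
move=> Ccvx gcvx fcvx [Cp pmin].
pose psi (z : 'rV[R]_n) (c : 'rV[R]_(n + n)) :=
  g (z + lsubmx c) + f (z + rsubmx c) + dotv d z.
have psicvx t z z' a a' : C z -> C z' -> 0 <= t -> t <= 1 ->
    psi (t *: z + (1 - t) *: z') (t *: a + (1 - t) *: a') <=
    t * psi z a + (1 - t) * psi z' a'.
  move=> Cz Cz' t0 t1; rewrite /psi !linearP /= !linearZ /= !dotvE.
  have E (b b' : 'rV[R]_n) : t *: z + (1 - t) *: z' + (t *: b + (1 - t) *: b')
      = t *: (z + b) + (1 - t) *: (z' + b') by rewrite addrACA !scalerDr.
  rewrite !E.
  have := gcvx t (z + lsubmx a) (z' + lsubmx a') t0 t1.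
  have := fcvx t (z + rsubmx a) (z' + rsubmx a') t0 t1.
  lra.
have psi0 z : psi z 0 = g z + f z + dotv d z.
  by rewrite /psi !linear0 !addr0.
(* The midpoint of [(z, c)] and [(p, - c)] carries zero perturbation, where [p] is minimal; joint
   convexity then bounds [psi z c] from below. *)
have lb c : has_lbound [set psi z c | z in C].
  exists (2 * psi p 0 - psi p (- c)) => _ [z Cz <-].
  have h0 : 0 <= 2^-1 :> R by rewrite invr_ge0.
  have h1 : 2^-1 <= 1 :> R by rewrite invf_le1 // ler1n.
  have := psicvx 2^-1 z p c (- c) Cz Cp h0 h1.
  have -> : 1 - 2^-1 = 2^-1 :> R by field.
  rewrite [2^-1 *: - c]scalerN subrr.
  have := pmin _ (convex_setP Ccvx Cz Cp h0 h1).
  have -> : 1 - 2^-1 = 2^-1 :> R by field.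
  by rewrite -!psi0; lra.
have C0 : C !=set0 by exists p.
have [s sP] := subdifferential0_nonempty (inf_convex Ccvx C0 lb psicvx).
have key z a b : C z -> psi p 0 + dotv (lsubmx s) a + dotv (rsubmx s) b <=
    g (z + a) + f (z + b) + dotv d z.
  move=> Cz; have := sP (row_mx a b); rewrite subr0 dotv_row_mx => sab.
  have inf_le : inf [set psi z (row_mx a b) | z in C] <=
      g (z + a) + f (z + b) + dotv d z.
    apply: ge_inf; first exact: lb.
    by exists z => //; rewrite /psi row_mxKl row_mxKr.
  have : psi p 0 <= inf [set psi z 0 | z in C].
    apply: lb_le_inf; first by exists (psi p 0), p.
    by move=> _ [y Cy <-]; rewrite !psi0; exact: pmin.
  by move: sab inf_le; lra.
(* The equation forces the third vector. In [key], moving one argument at [z = p] gives each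
   subgradient inequality; at [z = y], shifting both arguments back to [p] leaves only linear terms,
   which is normality. *)
exists (lsubmx s), (rsubmx s), (- (lsubmx s + rsubmx s + d)).
split=> [y|y|y Cy|]; last by rewrite opprD addrA subrr sub0r.
- have := key p (y - p) 0 Cp.
  by rewrite psi0 addr0 (addrC p) subrK dotv0r; lra.
- have := key p 0 (y - p) Cp.
  by rewrite psi0 addr0 (addrC p) subrK dotv0r; lra.
- have := key y (p - y) (p - y) Cy.
  by rewrite psi0 (addrC y) subrK !dotvE; lra.
Qed.

(** * The proximal step and the dual gap function *)

(** Comparing [p] with [p + t (z - p)], the quadratic term differs from its linearization only at
    order [t ^ 2], which vanishes after division by [t] as [t] tends to 0. *)
Lemma argmin_on_linearize (R : realType) (n : nat) (C : set 'rV[R]_n)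
    (phi : 'rV[R]_n -> R) (c : R) (y p : 'rV[R]_n) :
  convex_set (C : set (convex_lmodType 'rV[R]_n)) -> is_convex phi -> 0 <= c ->
  argmin_on C (fun z => phi z + c * enorm (z - y) ^+ 2) p ->
  argmin_on C (fun z => phi z + dotv ((2 * c) *: (p - y)) z) p.
Proof.
move=> Ccvx phicvx c0 [Cp pmin]; split=> // z Cz.
suff : 0 <= phi z - phi p + 2 * c * dotv (p - y) (z - p) by rewrite !dotvE; lra.
set A := _ + _; set N := dotv (z - p) (z - p).
have cN : 0 <= c * N by rewrite mulr_ge0 ?dotv_ge0.
apply/ler_addgt0Pr => r r0.
(* Small enough that [t * (c * N) <= r]; adding [r] to the denominator keeps it positive if
   [c * N = 0] and ensures [t <= 1]. *)
pose t := r / (c * N + r).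
have D0 : 0 < c * N + r by rewrite ltr_wpDl.
have t0 : 0 < t by rewrite divr_gt0.
have t1 : t <= 1 by rewrite ler_pdivrMr // mul1r lerDr.
have tN : t * (c * N) <= r.
  by rewrite mulrAC ler_pdivrMr // ler_pM2l // lerDl ltW.
suff : 0 <= t * (A + t * (c * N)) by rewrite pmulr_rge0 //; move: tN; lra.
have := pmin _ (convex_setP Ccvx Cz Cp (ltW t0) t1).
have := phicvx t z p (ltW t0) t1.
have -> : t *: z + (1 - t) *: p - y = (p - y) + t *: (z - p).
  by apply/rowP => i; rewrite !mxE; ring.
rewrite !enorm_sqr [dotv (p - y + _) _]dotvDl !(dotvDr _ (p - y)) !dotvZl.
rewrite !dotvZr (dotvC (z - p) (p - y)) -/N /A.
move: (dotv (p - y) (p - y)) (dotv (p - y) (z - p)) => a b.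
by clear; lra.
Qed.

Lemma is_convexD (R : realType) (V : lmodType R) (g f : V -> R) :
  is_convex g -> is_convex f -> is_convex (fun z => g z + f z).
Proof.
move=> gcvx fcvx t x y t0 t1.
have := gcvx t x y t0 t1; have := fcvx t x y t0 t1; lra.
Qed.

Lemma is_convexZ (R : realType) (V : lmodType R) (f : V -> R) (c : R) :
  is_convex f -> 0 <= c -> is_convex (fun z => c * f z).
Proof.
move=> fcvx c0 t x y t0 t1.
have := ler_wpM2l c0 (fcvx t x y t0 t1); lra.
Qed.

Lemma subdifferential_scale (R : realType) (n : nat) (f : 'rV[R]_n -> R) (c : R)
    (p u : 'rV[R]_n) :
  0 < c -> subdifferential (fun z => c * f z) p u ->
  subdifferential f p (c^-1 *: u).
Proof.
move=> c0 uP y; rewrite dotvZl -(ler_pM2l c0) mulrDr mulrA mulfV ?gt_eqF //.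
by rewrite mul1r uP.
Qed.

(* By monotonicity [F y . (x - y) <= F x . (x - y)], which is affine in [y]: this
   bounds the supremum on a bounded [C]. *)
Lemma dual_gap_convex (R : realType) (n : nat) (F : 'rV[R]_n -> 'rV[R]_n)
    (C : set 'rV[R]_n) :
  monotone_map F -> bounded_set C -> C !=set0 -> is_convex (dual_gap F C).
Proof.
move=> Fmono [M0 [_ M0P]] [y0 Cy0].
have [M CM] : exists M, forall y, C y -> `|y| <= M.
  (* Boundedness only provides bounds strictly above [M0]. *)
  by exists (M0 + 1); apply: M0P; rewrite ltrDl.
have ub x : has_ubound [set dotv (F y) (x - y) | y in C].
  exists (dotv (F x) x + (\sum_(i < n) `|F x ord0 i|) * M) => _ [y Cy <-].
  have := dotv_le_norm (- F x) y.
  under eq_bigr do rewrite mxE normrN.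
  have : (\sum_(i < n) `|F x ord0 i|) * `|y| <=
         (\sum_(i < n) `|F x ord0 i|) * M.
    by rewrite ler_wpM2l ?sumr_ge0 //; exact: CM.
  by have := Fmono y x; rewrite !dotvE; lra.
(* For fixed [y] the expression is affine in the point, and a supremum of affine functions is
   convex. *)
move=> t x x' t0 t1; apply: ge_sup => [|_ [y Cy <-]].
  by exists (dotv (F y0) (t *: x + (1 - t) *: x' - y0)), y0.
have le_gap z : dotv (F y) (z - y) <= dual_gap F C z.
  by apply: ub_le_sup; [exact: ub | exists y].
have := ler_wpM2l t0 (le_gap x).
have t1' : 0 <= 1 - t by rewrite subr_ge0.
have := ler_wpM2l t1' (le_gap x').
by rewrite !dotvE; lra.
Qed.

Theorem proposition3p2 (R : realType) (n : nat)
    (f : 'rV[R]_n -> R) (C : set 'rV[R]_n) (F : 'rV[R]_n -> 'rV[R]_n)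
    (eps lambda : nat -> R) (x : nat -> 'rV[R]_n) (delta : R)
    (f_convex : convex_function [set: convex_lmodType 'rV[R]_n] f)
    (C_closed : closed C)
    (C_convex : convex_set (C : set (convex_lmodType 'rV[R]_n)))
    (C_compact : compact C)
    (F_continuous : continuous F)
    (F_monotone : monotone_map F)
    (VI_nonempty : vi_solutions F C !=set0)
    (eps_gt0 : forall k, 0 < eps k)
    (eps_noninc : nonincreasing_seq eps)
    (eps_cvg0 : eps k @[k --> \oo] --> (0 : R))
    (lambda_gt0 : forall k, 0 < lambda k)
    (x_step : forall k,
       argmin_on C (fun z => dual_gap F C z + eps k * f z
                     + (2 * lambda k)^-1 * enorm (z - x k) ^+ 2) (x k.+1))
    (delta_gt0 : 0 < delta) :
  (forall k, enorm (x k.+1 - x k) <= lambda k * eps k * delta ->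
     stopping_criterion f F C delta (x k.+1))
  /\
  ((\forall k \near \oo, enorm (x k.+1 - x k) <= lambda k * eps k * delta) ->
   \forall k \near \oo, stopping_criterion f F C delta (x k.+1)).
Proof.
suff main k : enorm (x k.+1 - x k) <= lambda k * eps k * delta ->
    stopping_criterion f F C delta (x k.+1).
  by split=> [//|]; apply: filterS => k; exact: main.
move=> step.
have e0 := eps_gt0 k; have l0 := lambda_gt0 k.
have C0 : C !=set0 by exists (x 1%N); case: (x_step 0).
have gcvx := dual_gap_convex F_monotone (compact_bounded C_compact) C0.
have efcvx := is_convexZ (convex_function_is_convex f_convex) (ltW e0).
have l20 : 0 <= (2 * lambda k)^-1 by rewrite invr_ge0 mulr_ge0 // ltW.
have /(argmin_on_sum_rule C_convex gcvx efcvx) [w [u [v [wP uP vP wuv]]]] :=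
  argmin_on_linearize C_convex (is_convexD gcvx efcvx) l20 (x_step k).
have i0 : 0 < (eps k)^-1 by rewrite invr_gt0.
(* [u] is a subgradient of [eps k * f], so it is rescaled along with [v]; [w] stays and its factor
   becomes the multiplier. *)
exists ((eps k)^-1 *: u), w, ((eps k)^-1 *: v), (eps k)^-1; split=> //.
- exact: subdifferential_scale.
- by move=> y Cy; rewrite dotvZl pmulr_rle0 //; exact: vP.
- exact: ltW.
- rewrite -!scalerDr (addrC u) wuv -scalerN scalerA -scaleN1r scalerA enormZ.
  have -> : (eps k)^-1 * (2 / (2 * lambda k)) * -1 = - (lambda k * eps k)^-1.
    by field; rewrite !gt_eqF.
  have le0 : 0 < lambda k * eps k by rewrite mulr_gt0.
  by rewrite normrN gtr0_norm ?invr_gt0 // ler_pdivrMl.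
Qed.
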